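(* Let $\mathfrak{n}$ be an $n$-dimensional real vector space, $\gamma$ a tensor (or set of tensors) on $\mathfrak{n}$ of one of the classes considered, and $\langle\cdot,\cdot\rangle$ an inner product on $\mathfrak{n}$ compatible with $\gamma$. Let $m:V\to\mathfrak{p}$ and $m_\gamma:V\to\mathfrak{p}_\gamma$ be the moment maps for the actions of $\mathrm{GL}(n)$ and $G_\gamma$ on $V=\Lambda^2\mathfrak{n}^*\otimes\mathfrak{n}$, respectively, where $\mathfrak{p}$ is the space of symmetric maps of $(\mathfrak{n},\langle\cdot,\cdot\rangle)$ and $\mathfrak{p}_\gamma=\mathfrak{p}\cap\mathfrak{g}_\gamma$ is the subspace of those leaving $\gamma$ invariant. (i) For each $\mu\in\mathcal{N}$, $m(\mu)=8\,\mathrm{Ric}_\mu$, where $\mathrm{Ric}_\mu$ is the Ricci operator of the Riemannian manifold $(N_\mu,\langle\cdot,\cdot\rangle)$. (ii) For each $\mu\in\mathcal{N}_\gamma$, $m_\gamma(\mu)=8\,\mathrm{Ric}^\gamma_\mu$, where $\mathrm{Ric}^\gamma_\mu$ is the invariant Ricci operator of $(N_\mu,\gamma,\langle\cdot,\cdot\rangle)$, that is, the orthogonal projection of the Ricci operator $\mathrm{Ric}_\mu$ on $\mathfrak{p}_\gamma$.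
   Context: $V=\Lambda^2\mathfrak{n}^*\otimes\mathfrak{n}$ is the space of skew-symmetric bilinear maps $\mathfrak{n}\times\mathfrak{n}\to\mathfrak{n}$, with the action $g.\mu(X,Y)=g\mu(g^{-1}X,g^{-1}Y)$ of $\mathrm{GL}(n)=\mathrm{GL}(\mathfrak{n})$ and the inner product $\langle\mu,\lambda\rangle=\sum_{ijk}\langle\mu(X_i,X_j),X_k\rangle\langle\lambda(X_i,X_j),X_k\rangle$, $\{X_i\}$ any orthonormal basis of $\mathfrak{n}$. $\mathcal{N}\subset V$ is the set of nilpotent Lie brackets (those $\mu$ satisfying the Jacobi identity and nilpotent), and $\mathcal{N}_\gamma\subset\mathcal{N}$ is the subset of those $\mu$ for which $\gamma$ is integrable (symplectic: $\gamma=\omega$ closed as a left invariant form; complex: $\gamma=J$ with vanishing Nijenhuis tensor; hypercomplex: each $J_i$ integrable; no condition for the 'almost' versions and for $\gamma=0$). For $\mu\in\mathcal{N}$, $N_\mu$ is the simply connected nilpotent Lie group with Lie algebra $(\mathfrak{n},\mu)$, and $\gamma$, $\langle\cdot,\cdot\rangle$ also denote the left invariant structures they define on $N_\mu$. $G_\gamma=\{\varphi\in\mathrm{GL}(n):\varphi.\gamma=\gamma\}$, with Lie algebra $\mathfrak{g}_\gamma$. The classes in mind (with compatible inner products) are: (almost-)symplectic ($\gamma=\omega$ non-degenerate 2-form; compatible: $\omega=\langle\cdot,J\cdot\rangle$ with $J^2=-I$), (almost-)complex ($\gamma=J$, $J^2=-I$; compatible: $J$ orthogonal), (almost-)hypercomplex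 ($\gamma=\{J_1,J_2,J_3\}$ satisfying the quaternion relations; compatible: all $J_i$ orthogonal), and $\gamma=0$. In these cases $G_\gamma$ is reductive and $\mathfrak{g}_\gamma=\mathfrak{k}_\gamma\oplus\mathfrak{p}_\gamma$, where $\mathfrak{k}_\gamma=\mathfrak{g}_\gamma\cap\mathfrak{so}(\mathfrak{n},\langle\cdot,\cdot\rangle)$, is a Cartan decomposition. Moment map. $\mathfrak{p}$ is endowed with the inner product $\langle A,B\rangle_{\mathfrak{p}}=\mathrm{tr}\,AB$, and $\mathfrak{p}_\gamma$ with its restriction. For $\mu\in V$ and $g\in\mathrm{GL}(n)$ put $\rho_\mu(g)=\|g.\mu\|^2$. The moment map $m:V\to\mathfrak{p}$ for $\mathrm{GL}(n)$ is defined by $\langle m(\mu),A\rangle_{\mathfrak{p}}=(d\rho_\mu)_e(A)$ for all $A\in\mathfrak{p}$, and the moment map $m_\gamma:V\to\mathfrak{p}_\gamma$ for $G_\gamma$ by $\langle m_\gamma(\mu),A\rangle_{\mathfrak{p}}=(d\rho_\mu)_e(A)$ for all $A\in\mathfrak{p}_\gamma$. Orthogonal projections are with respect to $\langle\cdot,\cdot\rangle_{\mathfrak{p}}$. *)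

(* Defs.v *)
From HB Require Import structures.
From mathcomp Require Import all_boot all_order all_algebra.
From mathcomp Require Import sesquilinear.
From mathcomp Require Import ring lra.
From mathcomp Require Import boolp classical_sets reals topology normedtype derive.

Set Implicit Arguments.
Unset Strict Implicit.
Unset Printing Implicit Defensive.

Import Order.TTheory GRing.Theory Num.Theory.
Import numFieldNormedType.Exports.

Local Open Scope classical_set_scope.
Local Open Scope ring_scope.

Definition orthonormal_basis (R : realType) (E : vectType R)
    (ip : {dot E for idfun}) (n : nat) (X : n.-tuple E) : Prop :=
  basis_of fullv X /\ orthonormal ip X.

Section Brackets.
Variables (R : realType) (E : vectType R).
Implicit Types mu : {bilinear E -> E -> E}.

Fixpoint lower_central_series mu (k : nat) : {vspace E} :=
  if k is k'.+1 then
    <<[seq mu x y | x <- vbasis fullv, y <- vbasis (lower_central_series mu k')]>>%VS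
  else fullv.

Record nilpotent_lie_bracket mu : Prop := NilpotentLieBracket {
  bracket_skew : forall x y, mu x y = - mu y x;
  bracket_jacobi : forall x y z,
    mu x (mu y z) + mu y (mu z x) + mu z (mu x y) = 0;
  bracket_nilpotent : exists k, lower_central_series mu k = 0%VS }.

(** The Chevalley-Eilenberg differential, i.e. the exterior derivative of the
    left invariant 2-form [w]. *)
Definition closed_form mu (w : {skew_symmetric E}) : Prop :=
  forall x y z, w (mu x y) z + w (mu y z) x + w (mu z x) y = 0.

Definition nijenhuis mu (J : 'End(E)) (x y : E) : E :=
  mu (J x) (J y) - mu x y - J (mu (J x) y) - J (mu x (J y)).

(** The action of GL(E) on bilinear maps; meaningful for invertible [g]. *)
Definition act (g : 'End(E)) (mu : E -> E -> E) : E -> E -> E :=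
  fun x y => g (mu (g^-1%VF x) (g^-1%VF y)).

End Brackets.

Section Geometry.
Variables (R : realType) (E : vectType R).

Variant geometry : Type :=
| NoGeometry
| AlmostSymplectic of {skew_symmetric E}
| Symplectic of {skew_symmetric E}
| AlmostComplex of 'End(E)
| Complex of 'End(E)
| AlmostHypercomplex of 'End(E) & 'End(E) & 'End(E)
| Hypercomplex of 'End(E) & 'End(E) & 'End(E).

Definition complex_structure (J : 'End(E)) : Prop := (J \o J)%VF = - \1%VF.

Definition quaternionic (J1 J2 J3 : 'End(E)) : Prop :=
  [/\ complex_structure J1, complex_structure J2, complex_structure J3,
      (J1 \o J2)%VF = J3 & (J2 \o J1)%VF = - J3].

Definition is_geometry (gamma : geometry) : Prop :=
  match gamma with
  | NoGeometry => True
  | AlmostSymplectic w | Symplectic w => nondegenerate w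
  | AlmostComplex J | Complex J => complex_structure J
  | AlmostHypercomplex J1 J2 J3 | Hypercomplex J1 J2 J3 => quaternionic J1 J2 J3
  end.

Definition compatible (ip : {dot E for idfun}) (gamma : geometry) : Prop :=
  match gamma with
  | NoGeometry => True
  | AlmostSymplectic w | Symplectic w =>
      exists2 J : 'End(E), complex_structure J & forall x y, w x y = ip x (J y)
  | AlmostComplex J | Complex J => isometry ip ip J
  | AlmostHypercomplex J1 J2 J3 | Hypercomplex J1 J2 J3 =>
      [/\ isometry ip ip J1, isometry ip ip J2 & isometry ip ip J3]
  end.

Definition integrable (mu : {bilinear E -> E -> E}) (gamma : geometry) : Prop :=
  match gamma with
  | Symplectic w => closed_form mu w
  | Complex J => forall x y, nijenhuis mu J x y = 0
  | Hypercomplex J1 J2 J3 => forall x y,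
      [/\ nijenhuis mu J1 x y = 0, nijenhuis mu J2 x y = 0
        & nijenhuis mu J3 x y = 0]
  | NoGeometry | AlmostSymplectic _ | AlmostComplex _
  | AlmostHypercomplex _ _ _ => True
  end.

Definition fixes_endo (g J : 'End(E)) : Prop := (g \o J \o g^-1)%VF = J.

(** [g.gamma = gamma]; a set of tensors is fixed when each of its members is. *)
Definition fixes (g : 'End(E)) (gamma : geometry) : Prop :=
  match gamma with
  | NoGeometry => True
  | AlmostSymplectic w | Symplectic w =>
      forall x y, w (g^-1%VF x) (g^-1%VF y) = w x y
  | AlmostComplex J | Complex J => fixes_endo g J
  | AlmostHypercomplex J1 J2 J3 | Hypercomplex J1 J2 J3 =>
      [/\ fixes_endo g J1, fixes_endo g J2 & fixes_endo g J3]
  end.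

Definition GL : set 'End(E) := [set g | lker g == 0%VS].

Definition G_ (gamma : geometry) : set 'End(E) :=
  [set g | GL g /\ fixes g gamma].

Variable ip : {dot E for idfun}.

(** The Lie algebra of a closed subgroup [G] of GL(E): the velocities at the
    identity of the curves lying in [G]. Differentiability of a curve of
    endomorphisms is taken on its matrix coefficients. *)
Definition lie_algebra (G : set 'End(E)) : set 'End(E) :=
  [set A | exists c : R -> 'End(E),
     [/\ c 0 = \1%VF, forall t, G (c t)
       & forall x y, is_derive (0 : R) (1 : R)
           (fun t => ip (c t x) y : R) (ip (A x) y)]].

Definition frak_p : set 'End(E) := [set A | forall x y, ip (A x) y = ip x (A y)].

Definition frak_p_ (gamma : geometry) : set 'End(E) :=
  frak_p `&` lie_algebra (G_ gamma).

End Geometry.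

(** [X] is an orthonormal basis in everything below. *)
Section MomentMap.
Variables (R : realType) (E : vectType R) (ip : {dot E for idfun}).
Variables (n : nat) (X : n.-tuple E).
Implicit Types (mu : E -> E -> E) (A B : 'End(E)).

Definition trace A : R := \sum_i ip (A (tnth X i)) (tnth X i).

Definition ip_p A B : R := trace (A \o B)%VF.

Definition ip_V (mu lambda : E -> E -> E) : R :=
  \sum_i \sum_j \sum_k
    ip (mu (tnth X i) (tnth X j)) (tnth X k) *
    ip (lambda (tnth X i) (tnth X j)) (tnth X k).

Definition rho mu (g : 'End(E)) : R := ip_V (act g mu) (act g mu).

(** The differential of [rho mu] at the identity, as a derivative along
    [1 + t A], which lies in GL(E) for small [t]. *)
Definition drho mu A : R :=
  derive1 (fun t : R => rho mu (\1%VF + t *: A)) 0.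

(** The element of the subspace [P] of [frak_p] that represents [drho mu] on [P]
    with respect to [ip_p]. *)
Definition moment_map_on (P : set 'End(E)) mu : 'End(E) :=
  xget 0 [set B | P B /\ forall A, P A -> ip_p B A = drho mu A].

Definition moment_map mu : 'End(E) := moment_map_on (frak_p ip) mu.

Definition moment_map_ (gamma : geometry E) mu : 'End(E) :=
  moment_map_on (frak_p_ ip gamma) mu.

Definition orthogonal_projection (P : set 'End(E)) A : 'End(E) :=
  xget 0 [set B | P B /\ forall C, P C -> ip_p (A - B) C = 0].

End MomentMap.

(** Geometry of the left invariant metric [ip] on the simply connected Lie group
    N_mu, expressed on left invariant vector fields, i.e. on E. On these the
    functions <Y, Z> are constant, so the Koszul formula of the Levi-Civita
    connection only involves the bracket; by [levi_civitaP] below this is the only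
    connection on left invariant fields that is torsion-free and metric. *)
Section Ricci.
Variables (R : realType) (E : vectType R) (ip : {dot E for idfun}).
Variables (n : nat) (X : n.-tuple E).
Variable mu : {bilinear E -> E -> E}.

Definition levi_civita (x y : E) : E :=
  \sum_i (2^-1 * (ip (mu x y) (tnth X i) - ip (mu y (tnth X i)) x
                  + ip (mu (tnth X i) x) y)) *: tnth X i.

Definition curvature (x y z : E) : E :=
  levi_civita x (levi_civita y z) - levi_civita y (levi_civita x z)
  - levi_civita (mu x y) z.

(** ric(x, y) is the trace of the map z |-> R(z, x) y. *)
Definition ricci_tensor (x y : E) : R :=
  \sum_i ip (curvature (tnth X i) x y) (tnth X i).

(** <Ric x, y> = ric(x, y) *)
Definition Ric : 'End(E) :=
  linfun (fun x => \sum_i ricci_tensor x (tnth X i) *: tnth X i).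

Definition Ric_ (gamma : geometry E) : 'End(E) :=
  orthogonal_projection ip X (frak_p_ ip gamma) Ric.

End Ricci.


Section OrthonormalBasis.
Variables (R : realType) (E : vectType R) (ip : {dot E for idfun}).

Let ipBl x y z : ip (x - y) z = ip x z - ip y z. Proof. exact: linearBl. Qed.
Let ipZl a x z : ip (a *: x) z = a * ip x z. Proof. exact: linearZl_LR. Qed.
Let ipZr a x z : ip z (a *: x) = a * ip z x. Proof. exact: linearZr_LR. Qed.
Let ip_suml I r (P : pred I) F z :
  ip (\sum_(i <- r | P i) F i) z = \sum_(i <- r | P i) ip (F i) z.
Proof. exact: linear_sumlz. Qed.
Let ip_sumr I r (P : pred I) F z :
  ip z (\sum_(i <- r | P i) F i) = \sum_(i <- r | P i) ip z (F i).
Proof. exact: linear_sumr. Qed.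

Lemma ipC x y : ip x y = ip y x.
Proof. by rewrite (hermC ip) /= expr0 mul1r. Qed.

Lemma ip_gt0 u : u != 0 -> 0 < ip u u.
Proof. exact: neq0_dnorm_gt0. Qed.

Lemma ip_inj u v : (forall z, ip u z = ip v z) -> u = v.
Proof.
move=> h; apply/eqP; rewrite -subr_eq0; apply/negP => /negP /ip_gt0.
by rewrite ipBl h subrr ltxx.
Qed.

Lemma orthonormal_basis_exists :
  exists X : (\dim {:E}).-tuple E, orthonormal_basis ip X.
Proof.
suff main (d : nat) (U : {vspace E}) : \dim U = d ->
    exists2 s : seq E, basis_of U s & orthonormal ip s.
  have [s bs os] := main _ {:E}%VS erefl.
  have sz : size s == \dim {:E} by rewrite (size_basis (X := in_tuple s) bs).
  by exists (Tuple sz); split.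
elim: d U => [|d IHd] U dU.
  exists [::] => //; rewrite basisEdim /= dU leqnn andbT.
  by move/eqP: dU; rewrite dimv_eq0 => /eqP ->; rewrite sub0v.
have U0 : U != 0%VS by rewrite -dimv_eq0 dU.
set v := vpick U; have v0 : v != 0 by rewrite vpick0.
have vU : v \in U by exact: memv_pick.
set u := (Num.sqrt (ip v v))^-1 *: v.
have uU : u \in U by rewrite memvZ.
have uu : ip u u = 1.
  have sv : 0 < Num.sqrt (ip v v) by rewrite sqrtr_gt0 ip_gt0.
  rewrite /u ipZl ipZr mulrA -invfM -expr2.
  by rewrite sqr_sqrtr ?ltW ?ip_gt0 // mulVf // gt_eqF ?ip_gt0.
have uu0 : ip u u != 0 by rewrite uu oner_eq0.
have uN : u \notin orthov ip U.
  by apply/mem_orthovPn; exists u => //; exact: uu0.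
set W := (U :&: orthov ip <[u]>)%VS.
have dW : \dim W = d by rewrite -(eq_dim_orthov1 uN) dU.
have [s bs os] := IHd _ dW.
have us x : x \in s -> ip u x = 0.
  move=> xs; have : x \in W by exact: (basis_mem bs).
  by rewrite memv_cap mem_orthov1 => /andP[_ /eqP]; rewrite ipC.
exists (u :: s); last first.
  move: os; rewrite /orthonormal /= => /andP[-> ->]; rewrite uu eqxx /= !andbT.
  by apply/allP => x /us /= ->.
have uW : u \notin W.
  by rewrite memv_cap negb_and mem_orthov1; apply/orP; right; exact: uu0.
rewrite basisEfree free_cons (span_basis bs) uW (basis_free bs) /=.
have -> : size s = d by rewrite -dW (size_basis (X := in_tuple s) bs).
rewrite dU leqnn andbT span_cons (span_basis bs).
by rewrite subv_add -memvE uU capvSl.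
Qed.

Variables (n : nat) (X : n.-tuple E) (hX : orthonormal_basis ip X).

Lemma orthonormal_expand x : x = \sum_i ip x (tnth X i) *: tnth X i.
Proof.
case: hX => bX oX.
have ipX (i j : 'I_n) : ip (tnth X j) (tnth X i) = (i == j)%:R.
  case: eqVneq => [->|ij].
    by move/andP: oX => [/allP/(_ _ (mem_tnth j X))/eqP].
  move: oX; rewrite orthonormalE => /andP[_ /andP[_ oX]].
  have : forall s : seq E, pair_ortho_rec ip s -> forall a b, (a < b < size s)%N ->
      ip (nth 0 s a) (nth 0 s b) = 0.
    elim=> [|y s IHs] //=; first by move=> _ a b; rewrite ltn0 andbF.
    move=> /andP[/andP[ys _] os] a b /andP[].
    case: a b => [|a] [|b] //= ab bs.
      by apply/eqP; move/allP: ys; apply; rewrite mem_nth.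
    by apply: IHs => //; apply/andP; split.
  move=> /(_ _ oX) H; rewrite !(tnth_nth 0).
  have [lt|gt|/val_inj e] := ltngtP (val i) (val j).
  - by rewrite ipC H // lt size_tuple ltn_ord.
  - by rewrite H // gt size_tuple ltn_ord.
  - by rewrite e eqxx in ij.
rewrite {1}(coord_basis bX (memvf x)).
apply: eq_bigr => i _; rewrite -tnth_nth; congr (_ *: _).
rewrite {2}(coord_basis bX (memvf x)) ip_suml (bigD1 i) //= big1.
  by rewrite ipZl -tnth_nth ipX eqxx mulr1 addr0.
by move=> j ji; rewrite ipZl -tnth_nth ipX eq_sym (negbTE ji) /= mulr0.
Qed.

Lemma levi_civita_koszul (mu : {bilinear E -> E -> E}) x y z :
  ip (levi_civita ip X mu x y) z =
    2^-1 * (ip (mu x y) z - ip (mu y z) x + ip (mu z x) y).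
Proof.
have mul : mu z x = \sum_i ip z (tnth X i) *: mu (tnth X i) x.
  rewrite {1}(orthonormal_expand z) linear_sumlz.
  by apply: eq_bigr => i _; rewrite linearZl_LR.
have mur : mu y z = \sum_i ip z (tnth X i) *: mu y (tnth X i).
  rewrite {1}(orthonormal_expand z) linear_sumr.
  by apply: eq_bigr => i _; rewrite linearZr_LR.
have muz : ip (mu x y) z = \sum_i ip z (tnth X i) * ip (mu x y) (tnth X i).
  rewrite {1}(orthonormal_expand z) ip_sumr.
  by apply: eq_bigr => i _; rewrite ipZr.
rewrite mul mur muz !ip_suml -sumrB -big_split mulr_sumr.
apply: eq_bigr => i _; rewrite !ipZl (ipC _ z) /=; ring.
Qed.

Lemma levi_civitaP (mu : {bilinear E -> E -> E}) (nabla : E -> E -> E) :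
  (forall x y, mu x y = - mu y x) ->
  (forall x y, nabla x y = levi_civita ip X mu x y) <->
  (forall x y, nabla x y - nabla y x = mu x y) /\
  (forall x y z, ip (nabla x y) z + ip y (nabla x z) = 0).
Proof.
move=> skew; have sk x y z : ip (mu x y) z = - ip (mu y x) z.
  by rewrite skew -sub0r ipBl -{1}(scale0r 0) ipZl mul0r sub0r.
split=> [lc | [tf met] x y].
  split=> [x y|x y z].
    apply: ip_inj => z; rewrite ipBl !lc !levi_civita_koszul.
    rewrite (sk y x) (sk z y) (sk z x); field=> //=.
  rewrite (ipC y) !lc !levi_civita_koszul.
  rewrite (sk z x y) (sk z y x) (sk y x z); field=> //=.
apply: ip_inj => z; rewrite levi_civita_koszul -!tf !ipBl.
have := met x y z; have := met y z x; have := met z x y.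
rewrite (ipC x) (ipC y) (ipC z (nabla y x)); lra.
Qed.

End OrthonormalBasis.

(* Main.v *)
(** With A in the role of a tangent vector of GL(n), differentiating
    g.mu = g mu(g^-1 -, g^-1 -) at g = 1 gives
      (d rho_mu)(A) = 2 sum_ij <A mu_ij, mu_ij> - 4 sum_ij <mu(A X_i, X_j), mu_ij>,
    while the Koszul formula gives
      <Ric x, y> = - 1/2 sum_i <mu(x, X_i), mu(y, X_i)>
                   + 1/4 sum_ij <mu_ij, x> <mu_ij, y>,
    because the two remaining terms, which involve tr ad_x and the Killing form,
    vanish when mu is nilpotent. Hence (d rho_mu)(A) = 8 tr(Ric A) for symmetric A,
    so on any subspace of symmetric maps the representative of d rho_mu is 8 times
    the orthogonal projection of Ric. *)

From HB Require Import structures.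
Require Import Defs.
From mathcomp Require Import all_boot all_order all_algebra.
From mathcomp Require Import sesquilinear.
From mathcomp Require Import ring lra.
From mathcomp Require Import boolp classical_sets functions reals topology.
From mathcomp Require Import normedtype derive realfun.

Import Order.TTheory GRing.Theory Num.Theory.
Import numFieldNormedType.Exports.
Set Implicit Arguments.
Unset Strict Implicit.
Unset Printing Implicit Defensive.
Local Open Scope classical_set_scope.
Local Open Scope ring_scope.

(** Twice a double sum is the sum of its symmetrized summand, so two summands that agree only after
    adding the [(j, i)] entry still have equal sums. *)
Lemma eq_sum_sym (R : numDomainType) (I : finType) (F G : I -> I -> R) :
  (forall i j, F i j + F j i = G i j + G j i) ->
  \sum_i \sum_j F i j = \sum_i \sum_j G i j.
Proof.
move=> FG; apply: (mulIf (x := 2)); first by rewrite pnatr_eq0.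
have D (H : I -> I -> R) :
    (\sum_i \sum_j H i j) * 2 = \sum_i \sum_j (H i j + H j i).
  rewrite mulr_natr mulr2n {2}exchange_big -big_split.
  by apply: eq_bigr => i _; rewrite -big_split.
by rewrite !D; apply: eq_bigr => i _; apply: eq_bigr.
Qed.

(** * Traces and the form [ip_p] in an orthonormal frame *)

Section Metric.
Variables (R : realType) (E : vectType R) (ip : {dot E for idfun}).
Variables (n : nat) (X : n.-tuple E) (hX : orthonormal_basis ip X).
Implicit Types (A B F : 'End(E)) (P : set 'End(E)).

Local Notation e := (tnth X).

Lemma parseval x y : ip x y = \sum_i ip x (e i) * ip y (e i).
Proof.
rewrite {1}(orthonormal_expand hX x) linear_sumlz.
by apply: eq_bigr => i _; rewrite linearZl_LR /= (ipC ip y).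
Qed.

Lemma trace_comp A B :
  trace ip X (A \o B)%VF = \sum_i \sum_j ip (A (e i)) (e j) * ip (B (e j)) (e i).
Proof.
rewrite exchange_big; apply: eq_bigr => j _; rewrite comp_lfunE.
rewrite {1}(orthonormal_expand hX (B (e j))) linear_sum linear_sumlz.
by apply: eq_bigr => i _; rewrite linearZ linearZl_LR /= mulrC.
Qed.

Lemma trace_compC A B : trace ip X (A \o B)%VF = trace ip X (B \o A)%VF.
Proof.
rewrite !trace_comp exchange_big; apply: eq_bigr => i _.
by apply: eq_bigr => j _; rewrite mulrC.
Qed.

(* With P_k a projector onto U_k, invariance gives F P_k = P_{k+1} F P_k, so
   tr (F P_k) = tr (F P_k P_{k+1}) = tr (F P_{k+1}). *)
Lemma trace_flag F (U : nat -> {vspace E}) m :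
    U 0 = fullv -> U m = 0%VS -> (forall k, (U k.+1 <= U k)%VS) ->
    (forall k x, x \in U k -> F x \in U k.+1) ->
  trace ip X F = 0.
Proof.
move=> U0 Um Udec FU; pose p k := projv (U k).
have step k : trace ip X (F \o p k)%VF = trace ip X (F \o p k.+1)%VF.
  have -> : (F \o p k)%VF = (p k.+1 \o (F \o p k))%VF.
    apply/lfunP => x; rewrite !comp_lfunE [RHS]projv_id //.
    by apply: FU; exact: memv_proj.
  rewrite trace_compC -comp_lfunA; congr (trace ip X (F \o _)%VF).
  apply/lfunP => x; rewrite comp_lfunE projv_id //.
  by apply: (subvP (Udec k)); exact: memv_proj.
have -> : F = (F \o p 0)%VF.
  by apply/lfunP => x; rewrite comp_lfunE /= projv_id // U0 memvf.
have -> : trace ip X (F \o p 0)%VF = trace ip X (F \o p m)%VF.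
  by elim: m {Um} => // m ->.
rewrite /trace big1 // => i _; rewrite comp_lfunE /=.
have /eqP -> : p m (e i) == 0 by rewrite -memv0 -Um memv_proj.
by rewrite linear0 linear0l.
Qed.

Lemma ip_p_sym A B : ip_p ip X A B = ip_p ip X B A.
Proof. exact: trace_compC. Qed.

Lemma ip_pBl A B C : ip_p ip X (A - B) C = ip_p ip X A C - ip_p ip X B C.
Proof.
rewrite /ip_p /trace -sumrB; apply: eq_bigr => i _.
by rewrite !comp_lfunE add_lfunE opp_lfunE linearBl.
Qed.

Lemma ip_pZl a A C : ip_p ip X (a *: A) C = a * ip_p ip X A C.
Proof.
rewrite /ip_p /trace mulr_sumr; apply: eq_bigr => i _.
by rewrite !comp_lfunE scale_lfunE linearZl_LR.
Qed.

(** For symmetric [C], [tr (C C)] is the sum of the squared lengths of the [C (e i)]. This yields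
    uniqueness of representatives and of projections. *)
Lemma ip_p_definite A B :
  frak_p ip A -> frak_p ip B -> ip_p ip X (A - B) (A - B) = 0 -> A = B.
Proof.
move=> sA sB; pose C := A - B; rewrite -/C => C0; apply/subr0_eq; rewrite -/C.
have sC x y : ip (C x) y = ip x (C y).
  by rewrite !(add_lfunE, opp_lfunE) linearBl linearBr /= sA sB.
move: C0; rewrite /ip_p /trace; under eq_bigr do rewrite comp_lfunE sC /=.
have ge0 x : 0 <= ip x x.
  by have [->|/ip_gt0/ltW//] := eqVneq x 0; rewrite linear0l.
move/eqP; rewrite psumr_eq0 => [/allP h|i _]; last exact: ge0.
apply/lfunP => x; rewrite zero_lfunE (orthonormal_expand hX x) linear_sum big1 //.
move=> i _; rewrite linearZ /=.
have [->|/(ip_gt0 ip)] := eqVneq (C (e i)) 0; first by rewrite scaler0.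
by have /eqP -> := h i (mem_index_enum _); rewrite ltxx.
Qed.

Lemma frak_p_scale a (B : 'End(E)) : frak_p ip B -> frak_p ip (a *: B).
Proof.
by move=> hB x y; rewrite !scale_lfunE linearZl_LR linearZr_LR /= hB.
Qed.

(** Run the curve at speed [a]: [t |-> c (t * a)] stays in [G] and has velocity [a *: B]. *)
Lemma lie_algebra_scale (G : set 'End(E)) a B :
  lie_algebra ip G B -> lie_algebra ip G (a *: B).
Proof.
case=> c [c0 cG dc]; exists (fun t => c (t * a)); split=> [|t|x y].
- by rewrite mul0r.
- exact: cG.
rewrite scale_lfunE linearZl_LR /=.
have da : is_derive (0 : R) (1 : R) (fun t : R => t * a) a.
  have := is_deriveM (is_derive_id (0 : R) (1 : R)) (is_derive_cst a (0 : R) (1 : R)).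
  by move/is_derive_eq; apply; rewrite scaler0 add0r /GRing.scale /= mulr1.
have dc0 : is_derive (0 * a : R) (1 : R) (fun t => ip (c t x) y : R) (ip (B x) y).
  by rewrite mul0r; exact: dc.
have := @is_derive1_comp _ _ (fun t => t * a) 0 _ _ dc0 da.
by rewrite /GRing.scale /= mulrC.
Qed.

End Metric.

(** * The Ricci operator of a nilpotent bracket *)

Section Nilpotent.
Variables (R : realType) (E : vectType R) (ip : {dot E for idfun}).
Variables (n : nat) (X : n.-tuple E) (hX : orthonormal_basis ip X).
Variable mu : {bilinear E -> E -> E}.

Local Notation e := (tnth X).
Local Notation lcs := (lower_central_series mu).

Lemma memv_lcs k x y : y \in lcs k -> mu x y \in lcs k.+1.
Proof.
move=> yk; rewrite (coord_vbasis (memvf x)) (coord_vbasis yk) linear_sumlz.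
apply: memv_suml => i _; rewrite linearZl_LR memvZ // linear_sumr.
apply: memv_suml => j _; rewrite linearZr_LR memvZ //.
apply: memv_span; apply/allpairsP.
by exists ((vbasis fullv)`_i, (vbasis (lcs k))`_j);
  split=> //=; rewrite mem_nth // size_tuple.
Qed.

Lemma lcs_decr k : (lcs k.+1 <= lcs k)%VS.
Proof.
elim: k => [|k IHk]; first exact: subvf.
apply/span_subvP => _ /allpairsP[[x y] /= [_ yk ->]].
by apply: memv_lcs; apply: (subvP IHk); apply: vbasis_mem.
Qed.

Hypothesis hmu : nilpotent_lie_bracket mu.

(** The lower central series is a decreasing flag from [fullv] that reaches 0 by nilpotency, so
    [trace_flag] applies. *)
Lemma trace_nilpotent (F : 'End(E)) :
  (forall k x, x \in lcs k -> F x \in lcs k.+1) -> trace ip X F = 0.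
Proof.
case: hmu => _ _ [m lcsm] hF.
by apply: (trace_flag hX (U := lcs) (m := m)) => //; exact: lcs_decr.
Qed.

Lemma trace_ad x : \sum_i ip (mu x (e i)) (e i) = 0.
Proof.
transitivity (trace ip X (linfun (mu x))).
  by apply: eq_bigr => i _; rewrite lfunE.
by apply: trace_nilpotent => k y yk; rewrite lfunE; exact: memv_lcs.
Qed.

Lemma killing_form_eq0 x y :
  \sum_i \sum_j ip (mu x (e i)) (e j) * ip (mu y (e j)) (e i) = 0.
Proof.
transitivity (trace ip X (linfun (mu x) \o linfun (mu y))%VF).
  rewrite (trace_comp hX); apply: eq_bigr => i _; apply: eq_bigr => j _.
  by rewrite !lfunE.
apply: trace_nilpotent => k z zk; rewrite comp_lfunE !lfunE.
by apply: memv_lcs; apply: (subvP (lcs_decr k)); exact: memv_lcs.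
Qed.

Local Notation lc := (levi_civita ip X mu).

Let skew x y z : ip (mu x y) z = - ip (mu y x) z.
Proof. by rewrite (bracket_skew hmu) linearNl. Qed.

Let ip_lc := levi_civita_koszul hX mu.

(** The Koszul formula turns each curvature term into structure constants; the divergence and
    Killing form terms then vanish by nilpotency. *)
Lemma ricci_tensorE x y :
  ricci_tensor ip X mu x y =
    - 2^-1 * (\sum_i ip (mu x (e i)) (mu y (e i)))
    + 4^-1 * (\sum_i \sum_j ip (mu (e i) (e j)) x * ip (mu (e i) (e j)) y).
Proof.
have mu0 z : mu z z = 0.
  have /eqP := bracket_skew hmu z z.
  by rewrite -addr_eq0 -mulr2n -scaler_nat scaler_eq0 pnatr_eq0 /= => /eqP.
(* The divergence of the left invariant field [z] is minus the trace of [ad_z]. *)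
have div_free z : \sum_i ip (lc (e i) z) (e i) = 0.
  transitivity (- (\sum_i ip (mu z (e i)) (e i))); last by rewrite trace_ad oppr0.
  rewrite -sumrN; apply: eq_bigr => i _.
  by rewrite ip_lc mu0 linear0l (skew (e i)); field.
have met u v w : ip (lc u v) w = - ip v (lc u w).
  by rewrite (ipC ip v) !ip_lc (skew w u) (skew w v) (skew v u); field.
pose a i j := ip (mu x (e i)) (e j); pose b i j := ip (mu y (e i)) (e j).
pose p i j := ip (mu (e i) (e j)) x; pose q i j := ip (mu (e i) (e j)) y.
(* The quarter term is the inner product of the derivatives of [y] along [e i] and of [e i] along
   [x], after moving one derivative across by [met]. The half term comes from the bracket term, with
   [mu x (e i)] expanded in the frame. *)
have curvE i : ip (curvature ip X mu (e i) x y) (e i) =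
    ip (lc (e i) (lc x y)) (e i) + \sum_j (4^-1 *
      ((- b i j - b j i + q j i) * (a i j - p i j - a j i))
      + 2^-1 * (a i j * (- b j i - b i j + q i j))).
  rewrite /curvature !linearBl /= -addrA; congr (_ + _).
  rewrite met opprK (parseval hX) big_split /=; congr (_ + _).
    apply: eq_bigr => j _; rewrite !ip_lc /a /b /p /q.
    by rewrite (skew (e i) y) (skew (e j) x); field.
  rewrite ip_lc (bracket_skew hmu (e i) x).
  rewrite (bracket_skew hmu _ y).
  rewrite {1 2 3}(orthonormal_expand hX (mu x (e i))).
  rewrite !(linearNl, linearNr) /= !(linear_sumlz, linear_sumr) /=.
  rewrite -!sumrN -!big_split /= mulr_sumr -sumrN.
  apply: eq_bigr => j _.
  rewrite !(linearZl_LR, linearZr_LR) /= /a /b /p /q.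
  by rewrite /GRing.scale /=; field.
rewrite /ricci_tensor (eq_bigr _ (fun i _ => curvE i)) big_split /= div_free add0r.
transitivity (\sum_i \sum_j
    (- 2^-1 * (a i j * b i j) + 4^-1 * (p i j * q i j) - 2^-1 * (a i j * b j i))).
  (* As [p] and [q] are antisymmetric, symmetrizing cancels all mixed products of [a] or [b] with
     [p] or [q]. The leftover [a i j * b j i] sums to the Killing form. *)
  apply: eq_sum_sym => i j.
  have -> : q j i = - q i j by exact: skew.
  have -> : p j i = - p i j by exact: skew.
  by field.
under [LHS]eq_bigr => i _ do rewrite !big_split /= sumrN -!mulr_sumr.
rewrite !big_split /= sumrN -!mulr_sumr killing_form_eq0 mulr0 subr0.
by congr (_ * _ + _); apply: eq_bigr => i _; rewrite (parseval hX).
Qed.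

Lemma RicE x y :
  ip (Ric ip X mu x) y =
    - 2^-1 * (\sum_i ip (mu x (e i)) (mu y (e i)))
    + 4^-1 * (\sum_i \sum_j ip (mu (e i) (e j)) x * ip (mu (e i) (e j)) y).
Proof.
pose r z := \sum_i ricci_tensor ip X mu z (e i) *: e i.
have rE z w : ip (r z) w =
    - 2^-1 * (\sum_i ip (mu z (e i)) (mu w (e i)))
    + 4^-1 * (\sum_i \sum_j ip (mu (e i) (e j)) z * ip (mu (e i) (e j)) w).
  rewrite linear_sumlz.
  under eq_bigr => k _ do rewrite linearZl_LR /= ricci_tensorE mulrDl -!mulrA !mulr_suml.
  rewrite big_split /= -!mulr_sumr; congr (_ * _ + _ * _).
    rewrite exchange_big; apply: eq_bigr => i _.
    rewrite [in RHS](orthonormal_expand hX w) linear_sumlz linear_sumr /=.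
    by apply: eq_bigr => k _; rewrite linearZl_LR linearZr_LR /= mulrC (ipC ip w).
  rewrite exchange_big; apply: eq_bigr => i _.
  under eq_bigr => k _ do rewrite mulr_suml.
  rewrite exchange_big; apply: eq_bigr => j _.
  rewrite [in RHS](orthonormal_expand hX w) linear_sumr mulr_sumr /=.
  by apply: eq_bigr => k _; rewrite linearZr_LR /= (ipC ip w); ring.
(* [linfun] can be evaluated by [lfunE] only on a linear map; linearity is read off the closed
   formula [rE] by pairing with an arbitrary [v]. *)
have r_lin : linear r.
  move=> c z w; apply: (ip_inj (ip := ip)) => v.
  rewrite linearDl linearZl_LR /= !rE.
  have -> : \sum_i ip (mu (c *: z + w) (e i)) (mu v (e i)) =
      c * (\sum_i ip (mu z (e i)) (mu v (e i)))
      + \sum_i ip (mu w (e i)) (mu v (e i)).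
    rewrite mulr_sumr -big_split; apply: eq_bigr => i _.
    by rewrite 2!linearDl !linearZl_LR.
  have -> : \sum_i \sum_j ip (mu (e i) (e j)) (c *: z + w) * ip (mu (e i) (e j)) v =
      c * (\sum_i \sum_j ip (mu (e i) (e j)) z * ip (mu (e i) (e j)) v)
      + \sum_i \sum_j ip (mu (e i) (e j)) w * ip (mu (e i) (e j)) v.
    rewrite mulr_sumr -big_split; apply: eq_bigr => i _.
    rewrite mulr_sumr -big_split; apply: eq_bigr => j _.
    by rewrite linearDr linearZr_LR /=; ring.
  by ring.
pose rl := GRing.isLinear.Build _ _ _ _ r r_lin.
pose r' : {linear E -> E} := HB.pack r rl.
by rewrite /Ric (lfunE r') rE.
Qed.

End Nilpotent.

(** The difference quotient differs from [b] by [t * r t], which tends to 0 because [r] is bounded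
    near 0. *)
Lemma is_derive_quadratic_remainder (R : realType) (f r : R -> R) (b C : R) :
    (\forall t \near (0 : R), f t = f 0 + t * b + t ^+ 2 * r t) ->
    (\forall t \near (0 : R), `|r t| <= C) ->
  is_derive (0 : R) (1 : R) f b.
Proof.
move=> fE rC.
suff h : h^-1 *: ((f \o shift 0) (h *: (1 : R)) - f 0) @[h --> 0^'] --> b.
  by apply: DeriveDef; [exact: cvgP h | exact: cvg_lim h].
apply/cvgrPdist_le => eps eps0.
(* Adding 1 keeps the denominator positive even when [C] is 0. *)
have D0 : 0 < eps / (`|C| + 1) by rewrite divr_gt0 // ltr_wpDl.
near=> t.
have t0 : t != 0 by near: t; exact: nbhs_dnbhs_neq.
have -> : b - t^-1 *: ((f \o shift 0) (t *: 1) - f 0) = - (t * r t).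
  rewrite /= addr0 /GRing.scale /= mulr1.
  have -> : f t = f 0 + t * b + t ^+ 2 * r t by near: t; exact: nbhs_dnbhs fE.
  by field.
rewrite normrN normrM.
have rt : `|r t| <= C by near: t; exact: nbhs_dnbhs rC.
have te : `|t| <= eps / (`|C| + 1) by near: t; exact: dnbhs0_le.
apply: (le_trans (ler_pM _ _ te (le_trans rt (ler_norm C)))) => //.
rewrite mulrAC ler_pdivrMr ?ltr_wpDl // ler_pM2l //.
by rewrite lerDl.
Unshelve. all: by end_near. Qed.

Lemma is_derive_sum_fun (R : realType) m (h : 'I_m -> R -> R) (dh : 'I_m -> R) x v :
  (forall i, is_derive x v (h i) (dh i)) ->
  is_derive x v (fun t => \sum_i h i t) (\sum_i dh i).
Proof. by move=> /is_derive_sum; rewrite fct_sumE. Qed.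

(** * Differentiating [rho mu] along [1 + t A] *)

Section Inverse.
Variables (R : realType) (E : vectType R) (ip : {dot E for idfun}).
Variables (n : nat) (X : n.-tuple E) (hX : orthonormal_basis ip X).
Variable A : 'End(E).

Local Notation e := (tnth X).
Local Notation g t := (\1 + t *: A)%VF.

(** [N] is the l1 norm in the frame, and [K], the entrywise l1 norm of [A], bounds its operator norm
    for [N]. *)
Let N x := \sum_i `|ip x (e i)|.
Let K := \sum_i \sum_j `|ip (A (e i)) (e j)|.

Let N_ge0 x : 0 <= N x. Proof. exact: sumr_ge0. Qed.

Let K_ge0 : 0 <= K. Proof. by apply: sumr_ge0 => i _; exact: sumr_ge0. Qed.

Let ip_le x y : `|ip x y| <= N x * N y.
Proof.
rewrite (parseval hX) /N mulr_suml.
apply: (le_trans (ler_norm_sum _ _ _)); apply: ler_sum => i _.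
rewrite normrM ler_wpM2l // (bigD1 i) //= lerDl; exact: sumr_ge0.
Qed.

Let N_A x : N (A x) <= K * N x.
Proof.
have -> : K * N x = \sum_j \sum_i `|ip (A (e i)) (e j)| * N x.
  by rewrite exchange_big /K mulr_suml; apply: eq_bigr => i _; rewrite mulr_suml.
apply: ler_sum => j _.
rewrite {1}(orthonormal_expand hX x) linear_sum linear_sumlz.
apply: (le_trans (ler_norm_sum _ _ _)); apply: ler_sum => i _.
rewrite linearZ linearZl_LR /= normrM mulrC ler_wpM2l // /N (bigD1 i) //= lerDl.
exact: sumr_ge0.
Qed.

(** By the triangle inequality [t A] absorbs at most half of [N x]. Hence [g t] is injective and its
    inverse has norm at most 2. *)
Let N_g t x : `|t| * K <= 2^-1 -> N x <= 2 * N (g t x).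
Proof.
move=> tK.
have : N x <= N (g t x) + `|t| * N (A x).
  rewrite /N mulr_sumr -big_split; apply: ler_sum => i _ /=.
  rewrite -normrM -linearZl_LR /= add_lfunE id_lfunE scale_lfunE linearDl /=.
  by apply: le_trans (ler_normB _ _); rewrite addrK.
have := ler_wpM2l (normr_ge0 t) (N_A x); rewrite mulrA.
have := ler_wpM2r (N_ge0 x) tK; lra.
Qed.

Let near_small : \forall t \near (0 : R), `|t| * K <= 2^-1.
Proof.
have K1 : 0 < K + 1 by rewrite ltr_wpDl.
near=> t.
have : `|t| <= 2^-1 / (K + 1).
  by near: t; apply: (@nbhs0_le R R^o); rewrite divr_gt0 ?invr_gt0.
rewrite ler_pdivlMr //; apply: le_trans.
by rewrite ler_wpM2l // lerDl.
Unshelve. all: by end_near. Qed.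

Let N_eq0 x : N x <= 0 -> x = 0.
Proof.
move=> Nx; have /eqP : N x = 0 by apply/le_anti; rewrite Nx N_ge0.
rewrite psumr_eq0 // => /allP h; rewrite (orthonormal_expand hX x) big1 // => i _.
by have := h i (mem_index_enum _); rewrite /= normr_eq0 => /eqP ->; rewrite scale0r.
Qed.

Let lker_g t : `|t| * K <= 2^-1 -> lker (g t) == 0%VS.
Proof.
move=> tK; rewrite -subv0; apply/subvP => x; rewrite memv_ker memv0 => /eqP gx.
apply/eqP/N_eq0; apply: le_trans (N_g x tK) _; rewrite gx.
by rewrite /N big1 ?mulr0 // => i _; rewrite linear0l normr0.
Qed.

Let inv_gE t x : `|t| * K <= 2^-1 ->
  (g t)^-1%VF x = x - t *: A ((g t)^-1%VF x).
Proof.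
move=> tK; have := lker0_lfunVK (lker_g tK) x.
by rewrite add_lfunE id_lfunE scale_lfunE => h; rewrite -{2}h addrK.
Qed.

(* (1 + t A)^-1 = 1 - t A + t^2 A^2 (1 + t A)^-1, and the last inverse stays bounded. *)
Lemma is_derive_inverse x y :
  is_derive (0 : R) (1 : R) (fun t => ip ((g t)^-1%VF x) y : R) (- ip (A x) y).
Proof.
pose h t := (g t)^-1%VF x.
apply: (@is_derive_quadratic_remainder _ _ (fun t => ip (A (A (h t))) y) _
  (* One [K] for each application of [A], and 2 for the inverse of [g t]. *)
  (K * (K * (2 * N x)) * N y)).
  near=> t.
  have tK : `|t| * K <= 2^-1 by near: t; exact: near_small.
  have -> : ip ((g 0)^-1%VF x) y = ip x y.
    rewrite (inv_gE x (t := 0)) ?scale0r ?subr0 // normr0 mul0r; lra.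
  have hE : h t = x - t *: A (h t) by exact: inv_gE.
  have AhE : A (h t) = A x - t *: A (A (h t)) by rewrite {1}hE linearB linearZ.
  rewrite -/(h t) {1}hE {1}AhE !linearBl !linearZl_LR !linearBl !linearZl_LR.
  by rewrite /GRing.scale /=; ring.
near=> t.
have tK : `|t| * K <= 2^-1 by near: t; exact: near_small.
apply: le_trans (ip_le _ _) _; rewrite ler_wpM2r //.
apply: le_trans (N_A _) _; rewrite ler_wpM2l //.
apply: le_trans (N_A _) _; rewrite ler_wpM2l //.
by apply: le_trans (N_g _ tK) _; rewrite lker0_lfunVK // lker_g.
Unshelve. all: by end_near. Qed.

Lemma inverse_add_scale0 x : (g 0)^-1%VF x = x.
Proof. by rewrite inv_gE ?scale0r ?subr0 // normr0 mul0r; lra. Qed.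

Variable mu : {bilinear E -> E -> E}.

Let is_derive_mu x y z :
  is_derive (0 : R) (1 : R) (fun t => ip (mu ((g t)^-1%VF x) ((g t)^-1%VF y)) z : R)
    (- ip (mu (A x) y) z - ip (mu x (A y)) z).
Proof.
(* In coordinates [mu] is a polynomial in the entries of its arguments, so the product rule for real
   functions suffices. *)
have muE u v : ip (mu u v) z =
    \sum_i \sum_j ip u (e i) * ip v (e j) * ip (mu (e i) (e j)) z.
  rewrite {1}(orthonormal_expand hX u) !linear_sumlz; apply: eq_bigr => i _.
  rewrite linearZl_LR linearZl_LR {1}(orthonormal_expand hX v) linear_sumr linear_sumlz.
  rewrite /= mulr_sumr; apply: eq_bigr => j _.
  by rewrite linearZr_LR linearZl_LR /= mulrA.
under eq_fun do rewrite muE.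
rewrite !muE -!sumrN -big_split; apply: is_derive_sum_fun => i.
rewrite -!sumrN -big_split; apply: is_derive_sum_fun => j.
have := is_deriveM (is_deriveM (is_derive_inverse x (e i)) (is_derive_inverse y (e j)))
  (is_derive_cst (ip (mu (e i) (e j)) z : R) (0 : R) (1 : R)).
move/is_derive_eq; apply.
rewrite /GRing.scale /= !inverse_add_scale0.
ring.
Qed.

Hypothesis hA : frak_p ip A.

Lemma drhoE :
  drho ip X mu A = 2 * \sum_i \sum_j
    (ip (A (mu (e i) (e j))) (mu (e i) (e j))
     - ip (mu (A (e i)) (e j)) (mu (e i) (e j))
     - ip (mu (e i) (A (e j))) (mu (e i) (e j))).
Proof.
pose d i j := A (mu (e i) (e j)) - mu (A (e i)) (e j) - mu (e i) (A (e j)).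
have act_derive x y z : is_derive (0 : R) (1 : R)
    (fun t => ip (act (g t) mu x y) z : R)
    (ip (A (mu x y) - mu (A x) y - mu x (A y)) z).
  (* Symmetry of [A] moves the outer factor [t A] onto the fixed vector [z]. *)
  have -> : (fun t => ip (act (g t) mu x y) z) =
      (fun t => ip (mu ((g t)^-1%VF x) ((g t)^-1%VF y)) z)
      + id * (fun t => ip (mu ((g t)^-1%VF x) ((g t)^-1%VF y)) (A z)) :> (R -> R).
    apply/funext => t; rewrite !fctE /act add_lfunE id_lfunE scale_lfunE.
    by rewrite linearDl linearZl_LR /= hA.
  have := is_deriveD (is_derive_mu x y z)
    (is_deriveM (is_derive_id (0 : R) (1 : R)) (is_derive_mu x y (A z))).
  move/is_derive_eq; apply.
  by rewrite !inverse_add_scale0 !linearBl /= hA /GRing.scale /=; ring.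
rewrite /drho derive1E.
have -> : 2 * \sum_i \sum_j
    (ip (A (mu (e i) (e j))) (mu (e i) (e j))
     - ip (mu (A (e i)) (e j)) (mu (e i) (e j))
     - ip (mu (e i) (A (e j))) (mu (e i) (e j))) =
  \sum_i \sum_j \sum_k 2 * (ip (mu (e i) (e j)) (e k) * ip (d i j) (e k)).
  rewrite mulr_sumr; apply: eq_bigr => i _; rewrite mulr_sumr; apply: eq_bigr => j _.
  by rewrite -mulr_sumr -(parseval hX) [in RHS](ipC ip) !linearBl.
apply: derive_val.
apply: is_derive_sum_fun => i; apply: is_derive_sum_fun => j.
apply: is_derive_sum_fun => k.
have := is_deriveM (act_derive (e i) (e j) (e k)) (act_derive (e i) (e j) (e k)).
move/is_derive_eq; apply.
rewrite /act !inverse_add_scale0 add_lfunE id_lfunE scale_lfunE scale0r addr0.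
by rewrite /GRing.scale /=; ring.
Qed.

End Inverse.

(** * Comparing the moment map with the Ricci operator *)

Section Moment.
Variables (R : realType) (E : vectType R) (ip : {dot E for idfun}).
Variables (n : nat) (X : n.-tuple E) (hX : orthonormal_basis ip X).
Variables (mu : {bilinear E -> E -> E}) (hmu : nilpotent_lie_bracket mu).

Local Notation e := (tnth X).

Lemma Ric_symmetric : frak_p ip (Ric ip X mu).
Proof.
move=> x y; rewrite (ipC ip x) !(RicE hX hmu); congr (_ * _ + _ * _).
  by apply: eq_bigr => i _; rewrite (ipC ip).
by apply: eq_bigr => i _; apply: eq_bigr => j _; rewrite mulrC.
Qed.

Lemma drho_Ric A : frak_p ip A -> drho ip X mu A = 8 * ip_p ip X (Ric ip X mu) A.
Proof.
move=> hA; rewrite (drhoE hX mu hA) /ip_p /trace.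
under [in RHS]eq_bigr => i _ do rewrite comp_lfunE (RicE hX hmu).
rewrite big_split /= -!mulr_sumr.
(* Parseval in [l], with [A] moved to the other side by symmetry. *)
have -> : \sum_l \sum_i \sum_j ip (mu (e i) (e j)) (A (e l)) * ip (mu (e i) (e j)) (e l)
    = \sum_i \sum_j ip (A (mu (e i) (e j))) (mu (e i) (e j)).
  rewrite exchange_big; apply: eq_bigr => i _; rewrite exchange_big.
  apply: eq_bigr => j _; rewrite [RHS](parseval hX).
  by apply: eq_bigr => l _; rewrite hA.
under eq_bigr => i _ do rewrite !sumrB.
rewrite !sumrB.
have -> : \sum_i \sum_j ip (mu (e i) (A (e j))) (mu (e i) (e j)) =
    \sum_i \sum_j ip (mu (A (e i)) (e j)) (mu (e i) (e j)).
  (* After swapping the indices, skewness in both factors gives two signs that cancel. *)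
  rewrite exchange_big; apply: eq_bigr => i _; apply: eq_bigr => j _.
  rewrite (bracket_skew hmu (e j)) (bracket_skew hmu (e j) (e i)).
  by rewrite linearNl linearNr opprK.
by field.
Qed.

(* Two representatives in [P] of the same functional on [P] differ by an element
   orthogonal to both, hence to itself. Both sides are the junk value [0] when
   there is no representative. *)
Lemma moment_map_on_Ric (P : set 'End(E)) :
    P `<=` frak_p ip -> (forall a B, P B -> P (a *: B)) ->
  moment_map_on ip X P mu = 8 *: orthogonal_projection ip X P (Ric ip X mu).
Proof.
move=> Pp Pscale.
have uniq B C : P B -> P C -> (forall A, P A -> ip_p ip X (B - C) A = 0) -> B = C.
  move=> PB PC BC; apply: (ip_p_definite hX); [exact: Pp | exact: Pp |].
  by rewrite ip_pBl !(ip_p_sym hX _ (B - C)) !BC // subrr.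
have projE B : P B -> (forall A, P A -> ip_p ip X (Ric ip X mu - B) A = 0) ->
    moment_map_on ip X P mu = 8 *: B.
  move=> PB hB; apply: xget_unique.
    split=> [|A PA]; first exact: Pscale.
    rewrite drho_Ric; last exact: Pp.
    by have /eqP := hB A PA; rewrite ip_pBl subr_eq0 ip_pZl => /eqP ->.
  move=> C [PC hC]; apply: uniq => // [|A PA]; first exact: Pscale.
  rewrite ip_pBl ip_pZl hC // drho_Ric; last exact: Pp.
  have /eqP := hB A PA; rewrite ip_pBl subr_eq0 => /eqP ->.
  by rewrite subrr.
rewrite /orthogonal_projection; case: xgetP => [B _ [PB hB]|none].
  exact: projE.
(* A representative [B] of [drho] would make [8^-1 *: B] a projection of [Ric]. *)
rewrite scaler0; apply: xgetPN => B [PB hB]; apply: (none (8^-1 *: B)).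
split=> [|A PA]; first exact: Pscale.
rewrite ip_pBl ip_pZl hB // drho_Ric; last exact: Pp.
by rewrite mulKf ?subrr ?pnatr_eq0.
Qed.

End Moment.

Theorem proposition4p2 (R : realType) (n : nat) (E : vectType R)
    (ip : {dot E for idfun}) (gamma : geometry E) (X : n.-tuple E)
    (hgamma : is_geometry gamma) (hcomp : compatible ip gamma)
    (hX : orthonormal_basis ip X) :
  (forall mu : {bilinear E -> E -> E}, nilpotent_lie_bracket mu ->
     moment_map ip X mu = 8 *: Ric ip X mu)
  /\
  (forall mu : {bilinear E -> E -> E}, nilpotent_lie_bracket mu ->
     integrable mu gamma ->
     moment_map_ ip X gamma mu = 8 *: Ric_ ip X mu gamma).
Proof.
split=> mu hmu => [|_]; last first.
  apply: (moment_map_on_Ric hX hmu) => [A [] //|a B [pB gB]].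
  by split; [exact: frak_p_scale | exact: lie_algebra_scale].
rewrite /moment_map (moment_map_on_Ric hX hmu) //; last exact: frak_p_scale.
(* [Ric] is symmetric, hence its own projection on [frak_p]. *)
congr (_ *: _); apply: xget_unique.
  split=> [|A _]; first exact: (Ric_symmetric hX hmu).
  by rewrite ip_pBl subrr.
move=> B [pB hB]; apply/esym/(ip_p_definite hX) => //; first exact: Ric_symmetric.
(* The orthogonality is tested on [Ric - B] itself, which is symmetric. *)
apply: hB; rewrite -scaleN1r => x y; rewrite !add_lfunE linearDl linearDr /=.
by rewrite (Ric_symmetric hX hmu) (frak_p_scale _ pB).
Qed.
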